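(* Let $\Theta\subseteq\mathbb{R}^p$ be a neighborhood of the origin, let $f:\mathbb{R}^n\times\Theta\to\mathbb{R}$, and assume that for each $\theta\in\Theta$ the map $x\mapsto f(x,\theta)$ is convex and $x\mapsto\nabla_x f(x,\theta)$ is Lipschitz continuous on $\mathbb{R}^n$. Let $s:\Theta\to\mathbb{R}^p$ be a $C^\infty$ vector field with $s(0)=0$ such that the trajectories of the exosystem $\dot\theta(t)=s(\theta(t))$, $t\ge 0$, are bounded. Let $x_\circ^\star\in\mathbb{R}^n$ be the (locally unique) point with $\nabla_x f(x_\circ^\star,0)=0$, and let $H_c:\Theta\to\mathbb{R}^n$ be of class $C^0$ with $H_c(0)=x_\circ^\star$. Then the parameter-feedback algorithm $x(t)=H_c(\theta(t))$ exactly asymptotically tracks a critical trajectory of $\min_{x\in\mathbb{R}^n} f(x,\theta(t))$ if and only if there exists a neighborhood $\Theta_\circ\subset\Theta$ of the origin such that $H_c$ zeros the gradient on the limit set $\Omega(\Theta_\circ)$.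
   Context: Here $\nabla_x f(x,\theta)\in\mathbb{R}^n$ is the gradient of $f$ with respect to $x$. A critical trajectory of $\min_x f(x,\theta(t))$ is a function $x^\star:[0,\infty)\to\mathbb{R}^n$ with $\nabla_x f(x^\star(t),\theta(t))=0$ for all $t\ge0$. Standing assumptions: a critical trajectory exists, every critical trajectory is continuous, and there exists a locally unique point $x_\circ^\star$ with $\nabla_x f(x_\circ^\star,0)=0$. Tracking: the algorithm $x(t)=H_c(\theta(t))$ exactly asymptotically tracks a critical trajectory if there exists a neighborhood $\Theta_s\subset\Theta$ of the origin such that, for each $\theta(0)\in\Theta_s$, the solution of $\dot\theta(t)=s(\theta(t))$, $y(t)=\nabla_x f(H_c(\theta(t)),\theta(t))$ satisfies $y(t)\to0$ as $t\to\infty$. Zeroing the gradient: $H_c:\Theta\to\mathbb{R}^n$ zeros the gradient on a set $\Theta'\subseteq\Theta$ if $\nabla_x f(H_c(\theta),\theta)=0$ for all $\theta\in\Theta'$. Limit set: $\theta_\omega\in\Theta$ is a limit point with respect to the initialization $\theta_\circ\in\Theta$ if there is a sequence $t_i\to\infty$ such that the solution of $\dot\theta=s(\theta)$ with $\theta(0)=\theta_\circ$ satisfies $\theta(t_i)\to\theta_\omega$. $\Omega(\theta_\circ)$ is the set of all limit points with respect to $\theta_\circ$, and $\Omega(\Theta_\circ)=\bigcup_{\theta_\circ\in\Theta_\circ}\Omega(\theta_\circ)$.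
   Formalization: Two assumptions are added, without which the claim is false: for each x the gradient ∇_x f(x,θ) is continuous in θ on Θ, and the closure of every exosystem trajectory lies in Θ (bounded trajectories do not accumulate at points outside Θ). *)

(* Defs.v *)
From HB Require Import structures.
From mathcomp Require Import all_boot all_order all_algebra.
From mathcomp Require Import all_classical all_reals all_analysis.

Set Implicit Arguments.
Unset Strict Implicit.
Unset Printing Implicit Defensive.

Import Order.TTheory GRing.Theory Num.Theory.
Import numFieldNormedType.Exports.
Local Open Scope classical_set_scope.
Local Open Scope ring_scope.

(* R^n is 'rV[R]_n. Functions on a subset Theta of R^p are total functions of
   which only the values on Theta matter. *)

Section smoothness.
Context {R : realType} {p : nat} {V : normedModType R}.
Implicit Types (U A : set 'rV[R]_p) (g : 'rV[R]_p -> V).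

(* Meant for U open: all partial derivatives of order at most k exist and are
   continuous on U. *)
Fixpoint class_C (k : nat) U g : Prop :=
  {in U, continuous g} /\
  if k is k'.+1 then
    forall i : 'I_p,
      (forall x, U x -> derivable g x (delta_mx 0 i)) /\
      class_C k' U (fun x => 'D_(delta_mx 0 i) g x)
  else True.

(* Smoothness on an arbitrary set: g extends smoothly to a neighbourhood of each
   point of A. For open A this is smoothness in the usual sense. *)
Definition smooth_on A g : Prop :=
  forall a, A a ->
    exists U (h : 'rV[R]_p -> V),
      [/\ open_nbhs a U, forall k, class_C k U h
        & forall x, A x -> U x -> h x = g x].

End smoothness.

Section time_varying_optimization.
Context {R : realType} {n p : nat}.

Definition grad (g : 'rV[R]_n -> R) (x : 'rV[R]_n) : 'rV[R]_n :=
  \row_i 'D_(delta_mx 0 i) (g : 'rV[R]_n -> R^o) x.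

Definition grad_x (f : 'rV[R]_n -> 'rV[R]_p -> R)
    (x : 'rV[R]_n) (theta : 'rV[R]_p) : 'rV[R]_n :=
  grad (f^~ theta) x.

(* Only the values of th on [0, +oo[ matter; at t = 0 the limit of difference
   quotients is the right derivative. *)
Definition exo_solution (Theta : set 'rV[R]_p) (s : 'rV[R]_p -> 'rV[R]_p)
    (th : R -> 'rV[R]_p) : Prop :=
  forall t, 0 <= t ->
    Theta (th t) /\
    (u - t)^-1 *: (th u - th t) @[u --> within [set u | 0 <= u] t^']
      --> s (th t).

Definition orbit_of (th : R -> 'rV[R]_p) : set 'rV[R]_p :=
  th @` [set t | 0 <= t].

Definition bounded_trajectories (Theta : set 'rV[R]_p)
    (s : 'rV[R]_p -> 'rV[R]_p) : Prop :=
  (forall th0, Theta th0 -> exists2 th, exo_solution Theta s th & th 0 = th0) /\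
  (forall th, exo_solution Theta s th -> bounded_set (orbit_of th)).

Definition critical_trajectory (f : 'rV[R]_n -> 'rV[R]_p -> R)
    (th : R -> 'rV[R]_p) (x : R -> 'rV[R]_n) : Prop :=
  forall t, 0 <= t -> grad_x f (x t) (th t) = 0.

Definition locally_unique_critical_point (g : 'rV[R]_n -> R)
    (x0 : 'rV[R]_n) : Prop :=
  grad g x0 = 0 /\ \forall x \near x0, grad g x = 0 -> x = x0.

Definition exactly_asymptotically_tracks (Theta : set 'rV[R]_p)
    (f : 'rV[R]_n -> 'rV[R]_p -> R) (s : 'rV[R]_p -> 'rV[R]_p)
    (Hc : 'rV[R]_p -> 'rV[R]_n) : Prop :=
  exists Theta_s : set 'rV[R]_p,
    [/\ nbhs (0 : 'rV[R]_p) Theta_s, Theta_s `<=` Theta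
      & forall th, exo_solution Theta s th -> Theta_s (th 0) ->
          grad_x f (Hc (th t)) (th t) @[t --> +oo] --> (0 : 'rV[R]_n)].

Definition zeros_gradient_on (f : 'rV[R]_n -> 'rV[R]_p -> R)
    (Hc : 'rV[R]_p -> 'rV[R]_n) (A : set 'rV[R]_p) : Prop :=
  forall theta, A theta -> grad_x f (Hc theta) theta = 0.

Definition limit_points_from (Theta : set 'rV[R]_p)
    (s : 'rV[R]_p -> 'rV[R]_p) (th0 : 'rV[R]_p) : set 'rV[R]_p :=
  [set thw | Theta thw /\
     exists (th : R -> 'rV[R]_p) (t_ : R^nat),
       [/\ exo_solution Theta s th, th 0 = th0,
           t_ i @[i --> \oo] --> +oo & th (t_ i) @[i --> \oo] --> thw]].

Definition limit_set (Theta : set 'rV[R]_p) (s : 'rV[R]_p -> 'rV[R]_p)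
    (Theta0 : set 'rV[R]_p) : set 'rV[R]_p :=
  \bigcup_(th0 in Theta0) limit_points_from Theta s th0.

End time_varying_optimization.

(* Main.v *)
(* Gradients of convex functions are monotone maps, and pointwise limits of
   monotone maps with a continuous limit are locally uniform. Hence the separate
   continuity of grad_x f in x and in theta is joint, and
   G(theta) = grad_x f (Hc theta) theta is continuous on Theta. If G tends to 0
   along a trajectory, it vanishes at every limit point of it; conversely, if G
   stayed away from 0 along times t_i -> +oo, compactness of the closed orbit
   would produce a limit point at which G does not vanish. *)

Require Import Defs.
From HB Require Import structures.
From mathcomp Require Import all_boot all_order all_algebra.
From mathcomp Require Import all_classical all_reals all_analysis.
From mathcomp Require Import ring lra.

Set Implicit Arguments.
Unset Strict Implicit.
Unset Printing Implicit Defensive.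

Import Order.TTheory GRing.Theory Num.Theory.
Import numFieldNormedType.Exports.
Local Open Scope classical_set_scope.
Local Open Scope ring_scope.

(** * Monotone maps and entrywise bounds in the maximum norm *)

Definition monotone_map (R : numDomainType) (n : nat)
    (G : 'rV[R]_n -> 'rV[R]_n) : Prop :=
  forall x y, 0 <= \sum_i (G x - G y) 0 i * (x - y) 0 i.

Lemma ler_entry_norm (R : realFieldType) (m n : nat) (A : 'M[R]_(m, n)) i j :
  `|A i j| <= `|A|.
Proof.
by rewrite [leRHS]/Num.norm /= mx_normrE; apply: (le_bigmax _ _ (i, j)).
Qed.

Lemma mx_norm_le (R : realFieldType) (m n : nat) (A : 'M[R]_(m, n)) (e : R) :
  0 <= e -> (forall i j, `|A i j| <= e) -> `|A| <= e.
Proof.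
move=> e0 Ae; rewrite [leLHS]/Num.norm /= mx_normrE.
by apply/bigmax_leP; split=> // -[i j].
Qed.

Lemma sum_entry_mul_le (R : realFieldType) (n : nat) (u v : 'rV[R]_n) :
  \sum_i u 0 i * v 0 i <= n%:R * `|u| * `|v|.
Proof.
apply: (@le_trans _ _ (\sum_(i < n) `|u| * `|v|)).
  apply: ler_sum => i _; apply: le_trans (ler_norm _) _.
  by rewrite normrM ler_pM// ler_entry_norm.
by rewrite sumr_const card_ord -mulrA mulr_natl.
Qed.

(** * Gradients of convex functions and limits of monotone maps *)

(** For [0 < h <= 1], convexity bounds the difference quotient by [g y - g x]; the limit from the
    right keeps the bound. *)
Lemma derive_convex_le (R : realType) (n : nat) (g : 'rV[R]_n -> R)
    (x y : 'rV[R]_n) :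
  convex_function (E := 'rV[R]_n) setT g ->
  derivable (g : 'rV[R]_n -> R^o) x (y - x) ->
  'D_(y - x) (g : 'rV[R]_n -> R^o) x <= g y - g x.
Proof.
move=> gconv gd; rewrite /derive cvg_at_rightE//.
apply: limr_le; first exact: cvgP (cvg_dnbhs_at_right gd).
near=> h.
have h0 : 0 < h by near: h; exact: nbhs_right_gt.
have h1 : h <= 1 by near: h; exact: nbhs_right_le.
have := gconv (Itv01 (ltW h0) h1) y x (in_setT _) (in_setT _).
rewrite convRE /= /unstable.onem.
have -> : @conv R (convex_lmodType 'rV[R]_n) (Itv01 (ltW h0) h1) y x
    = h *: (y - x) + x.
  rewrite /conv/= /unstable.onem scalerBr scalerBl scale1r.
  by rewrite -!addrA; congr (_ + _); rewrite addrC.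
move=> gh; rewrite /GRing.scale/= ler_pdivrMl//.
by rewrite -/(h *: (y - x)); lra.
Unshelve. all: by end_near.
Qed.

Lemma derive_gradE (R : realType) (n : nat) (g : 'rV[R]_n -> R)
    (x v : 'rV[R]_n) :
  differentiable (g : 'rV[R]_n -> R^o) x ->
  'D_v (g : 'rV[R]_n -> R^o) x = \sum_i grad g x 0 i * v 0 i.
Proof.
move=> gd; rewrite deriveE// {1}(row_sum_delta v) linear_sum.
by apply: eq_bigr => i _; rewrite linearZ mxE deriveE//= mulrC.
Qed.

(** Adding the first-order inequalities from [x] to [y] and back cancels the values of [g]. *)
Lemma grad_convex_monotone (R : realType) (n : nat) (g : 'rV[R]_n -> R) :
  convex_function (E := 'rV[R]_n) setT g ->
  (forall x, differentiable (g : 'rV[R]_n -> R^o) x) ->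
  monotone_map (grad g).
Proof.
move=> gconv gd x y.
have gdv z v : derivable (g : 'rV[R]_n -> R^o) z v by exact: diff_derivable.
have := derive_convex_le gconv (gdv x (y - x)).
have := derive_convex_le gconv (gdv y (x - y)).
rewrite !derive_gradE// => gyx gxy.
have -> : \sum_i (grad g x - grad g y) 0 i * (x - y) 0 i =
    - \sum_i grad g x 0 i * (y - x) 0 i - \sum_i grad g y 0 i * (x - y) 0 i.
  by rewrite -!sumrN -big_split; apply: eq_bigr => i _; rewrite !mxE /=; ring.
lra.
Qed.

(* Monotonicity tested at the points [y + r e_i] and [y - r e_i] bounds each
   coordinate of [G x] from above and below. *)
Lemma monotone_map_norm_le (R : realFieldType) (n : nat)
    (G : 'rV[R]_n -> 'rV[R]_n) (x y v : 'rV[R]_n) (r e : R) :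
  monotone_map G -> 0 < r -> 0 <= e -> n%:R * `|x - y| <= r / 2 ->
  (forall i, `|G (y + r *: delta_mx 0 i) - v| <= e) ->
  (forall i, `|G (y - r *: delta_mx 0 i) - v| <= e) ->
  `|G x - v| <= 3 * e.
Proof.
move=> Gmono r0 e0 xyr Gp Gm; set A := `|G x - v|.
(* [A] recurs on the right with factor 1/2 and is absorbed, which yields the constant 3. *)
suff : A <= e + (A + e) / 2 by lra.
have A0 : 0 <= A by exact: normr_ge0.
have side (c : R) i : `|c| = 1 ->
    `|G (y + (c * r) *: delta_mx 0 i) - v| <= e ->
    c * (G x - v) 0 i <= e + (A + e) / 2.
  move=> c1; set z := y + _ => Gz.
  have Gxz : `|G x - G z| <= A + e.
    have -> : G x - G z = (G x - v) - (G z - v).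
      by rewrite opprB addrA subrK.
    by rewrite (le_trans (ler_normB _ _))// lerD.
  have := Gmono x z.
  (* Splitting [x - z] isolates coordinate [i]. The remaining sum is at most [(A + e) * (r / 2)],
     and division by [r] leaves the factor 1/2. *)
  have -> : \sum_j (G x - G z) 0 j * (x - z) 0 j =
      \sum_j (G x - G z) 0 j * (x - y) 0 j - (c * r) * (G x - G z) 0 i.
    rewrite [X in _ = _ - X](_ : _ =
        \sum_j (G x - G z) 0 j * ((c * r) *: delta_mx 0 i : 'rV[R]_n) 0 j).
      by rewrite -sumrB; apply: eq_bigr => j _; rewrite /z !mxE; ring.
    rewrite (bigD1 i)//= big1 ?addr0 => [|j ji]; rewrite !mxE ?eqxx/=.
      by rewrite mulr1 mulrC.
    by rewrite (negbTE ji) !mulr0.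
  have S := sum_entry_mul_le (G x - G z) (x - y).
  have T : n%:R * `|G x - G z| * `|x - y| <= (A + e) * (r / 2).
    by rewrite mulrAC mulrC ler_pM// mulr_ge0.
  move=> mono.
  have cxz : c * (G x - G z) 0 i <= (A + e) / 2.
    by rewrite -(ler_pM2r r0); lra.
  have czv : c * (G z - v) 0 i <= e.
    rewrite (le_trans (ler_norm _))// normrM c1 mul1r.
    exact: le_trans (ler_entry_norm _ _ _) Gz.
  have -> : (G x - v) 0 i = (G x - G z) 0 i + (G z - v) 0 i.
    by rewrite !mxE; ring.
  by rewrite mulrDr; lra.
apply: mx_norm_le => [|i j]; first lra.
rewrite [i]ord1 ler_norml.
have := side 1 j (normr1 _); rewrite !mul1r => /(_ (Gp j)).
have := side (-1) j; rewrite normrN normr1 !mulN1r scaleNr => /(_ erefl (Gm j)).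
by move=> *; apply/andP; split; lra.
Qed.

(** Only the finitely many test points [x0 + r e_i] and [x0 - r e_i] matter, so pointwise
    convergence there controls [G t] at the moving point [x t]. *)
Lemma cvg_monotone_maps (R : realType) (n : nat) (T : Type) (F : set_system T)
    {FF : Filter F} (G : T -> 'rV[R]_n -> 'rV[R]_n) (g : 'rV[R]_n -> 'rV[R]_n)
    (x : T -> 'rV[R]_n) (x0 : 'rV[R]_n) :
  (\forall t \near F, monotone_map (G t)) ->
  (forall z, G t z @[t --> F] --> g z) -> {for x0, continuous g} ->
  x t @[t --> F] --> x0 -> G t (x t) @[t --> F] --> g x0.
Proof.
move=> Gmono Gg gcont xx0; apply/cvgrPdist_le => e e0.
(* Continuity of [g] and pointwise convergence each cost [e / 6]; their sum [e / 3] is tripled by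
   [monotone_map_norm_le]. *)
have e6 : 0 < e / 6 by lra.
have [r /= r0 gr] : exists2 r, 0 < r &
    forall z, `|x0 - z| <= r -> `|g x0 - g z| <= e / 6.
  move/cvgrPdist_le : gcont => /(_ _ e6) /nbhs_normP[d /= d0 gd].
  exists (d / 2); first lra.
  by move=> z x0z; apply: gd => /=; lra.
have norm_delta (c : R) (i : 'I_n) : `|c *: delta_mx 0 i : 'rV[R]_n| <= `|c|.
  apply: mx_norm_le => // k l; rewrite !mxE normrM.
  by rewrite ler_piMr//; case: (_ && _); rewrite ?normr1 ?normr0.
have near_le (c : R) (i : 'I_n) : `|c| <= r -> \forall t \near F,
    `|G t (x0 + c *: delta_mx 0 i) - g x0| <= e / 3.
  move=> cr; have /cvgrPdist_le /(_ _ e6) := Gg (x0 + c *: delta_mx 0 i).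
  apply: filterS => t Gt; rewrite distrC.
  have : `|g x0 - g (x0 + c *: delta_mx 0 i)| <= e / 6.
    by apply: gr; rewrite opprD addNKr normrN (le_trans (norm_delta _ _)).
  have := ler_distD (g (x0 + c *: delta_mx 0 i)) (g x0)
    (G t (x0 + c *: delta_mx 0 i)).
  lra.
have nearp : \forall t \near F, forall i : 'I_n,
    `|G t (x0 + r *: delta_mx 0 i) - g x0| <= e / 3.
  by apply: filter_forall => i; apply: near_le; rewrite gtr0_norm.
have nearm : \forall t \near F, forall i : 'I_n,
    `|G t (x0 - r *: delta_mx 0 i) - g x0| <= e / 3.
  apply: filter_forall => i; rewrite -scaleNr.
  by apply: near_le; rewrite normrN gtr0_norm.
(* The successor keeps the divisor positive when [n] is 0. *)
have rn : 0 < r / 2 / n.+1%:R by rewrite !divr_gt0.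
move/cvgrPdist_le : xx0 => /(_ _ rn) xx0.
near=> t; rewrite distrC (_ : e = 3 * (e / 3)); last by field.
apply: (@monotone_map_norm_le _ _ (G t) (x t) x0 _ r) => //.
- by near: t.
- lra.
- rewrite distrC (@le_trans _ _ (n.+1%:R * `|x0 - x t|))//.
    by rewrite ler_wpM2r// ler_nat.
  by rewrite mulrC -ler_pdivlMr//; near: t.
- by near: t.
- by near: t.
Unshelve. all: by end_near.
Qed.

Lemma lipschitz_continuous (R : realType) (V W : normedModType R) (f : V -> W) :
  lipschitz f -> continuous f.
Proof.
move=> [k [kr fk]] x; apply/cvgrPdist_le => e e0.
(* Every constant beyond the threshold [k] is a Lipschitz constant; this one is also positive. *)
have k1 : 0 < `|k| + 1 by rewrite ltr_wpDl.
have {}fk : (`|k| + 1).-lipschitz f.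
  by apply: fk; rewrite (le_lt_trans (ler_norm _))// ltrDl.
near=> y; rewrite (le_trans (fk (x, y) _))//= mulrC -ler_pdivlMr//.
by near: y; apply: cvgr_dist_le => //; rewrite divr_gt0.
Unshelve. all: by end_near.
Qed.

Lemma grad_along_continuous (R : realType) (n p : nat) (Theta : set 'rV[R]_p)
    (f : 'rV[R]_n -> 'rV[R]_p -> R) (h : 'rV[R]_p -> 'rV[R]_n) :
  (forall theta, Theta theta ->
     convex_function (E := 'rV[R]_n) setT (f^~ theta)) ->
  (forall theta, Theta theta ->
     forall x, differentiable (f^~ theta : 'rV[R]_n -> R^o) x) ->
  (forall theta, Theta theta -> continuous (fun x => grad_x f x theta)) ->
  (forall x, {within Theta, continuous (grad_x f x)}) ->
  {within Theta, continuous h} ->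
  {within Theta, continuous (fun theta => grad_x f (h theta) theta)}.
Proof.
move=> fconv fd gcont gtheta hcont; apply/subspace_continuousP => w Tw.
apply: (@cvg_monotone_maps _ _ _ _ _ (fun theta x => grad_x f x theta)
  (fun x => grad_x f x w) h (h w)).
- near=> theta; apply: grad_convex_monotone; [apply: fconv|apply: fd];
    by near: theta; exact: withinT.
- by move=> z; have /subspace_continuousP := gtheta z; exact.
- exact: gcont.
- by have /subspace_continuousP := hcont; exact.
Unshelve. all: by end_near.
Qed.

(** * Convergence along bounded trajectories and the equivalence *)

Lemma cvg_along_trajectory (R : realType) (p : nat) (V : normedModType R)
    (Theta : set 'rV[R]_p) (g : 'rV[R]_p -> V) (th : R -> 'rV[R]_p) (v : V) :
  {within Theta, continuous g} -> bounded_set (orbit_of th) ->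
  closure (orbit_of th) `<=` Theta ->
  (forall (w : 'rV[R]_p) (t_ : R^nat), Theta w -> t_ i @[i --> \oo] --> +oo ->
     th (t_ i) @[i --> \oo] --> w -> g w = v) ->
  g (th t) @[t --> +oo] --> v.
Proof.
move=> gcont thbnd thcl glim; apply/cvgrPdist_lt => e e0.
apply: contrapT => nlt.
pose bad := [set t : R | ~ `|v - g (th t)| < e].
(* The filter of orbit tails restricted to bad times; it is proper because, by [nlt], bad times
   occur arbitrarily late. *)
pose F : set_system 'rV[R]_p := th @ within bad (+oo : set_system R).
have FE A : F A = (\forall t \near +oo, bad t -> A (th t)) by [].
have FF : ProperFilter F.
  apply: Build_ProperFilter_ex => A FA; apply: contrapT => nA; apply: nlt.
  rewrite FE in FA.
  near=> t; apply: contrapT => badt; apply: nA; exists (th t).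
  by move: badt; near: t.
have Forbit : F (th @` [set t | 0 <= t /\ bad t]).
  rewrite FE; near=> t.
  suff t0 : 0 <= t by exists t.
  by near: t; exact: nbhs_pinfty_ge.
have Kcpt : compact (closure (orbit_of th)).
  apply: bounded_closed_compact; last exact: closed_closure.
  (* Bounds strictly above [M] are valid, hence [M + 1]; the slack [r - (M + 1)] is spent on
     approximating [w] by an orbit point. *)
  have [M [_ thM]] := thbnd; exists (M + 1);
  split=> [|r Mr w /= clw]; first exact: num_real.
  have [_ [[t t0 <-] /= wt]] : orbit_of th `&` ball w (r - (M + 1)) !=set0.
    by apply: clw; apply: nbhsx_ballx; rewrite subr_gt0.
  move: wt; rewrite -ball_normE /= => wt.
  have := ler_distD (th t) w 0; rewrite !subr0.
  have : `|th t| <= M + 1 by apply: thM; [rewrite ltrDl|exists t].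
  by lra.
have FK : F (closure (orbit_of th)).
  by apply: filterS Forbit => _ [t [t0 _] <-]; apply: subset_closure; exists t.
have [w [/thcl Tw Fw]] := Kcpt F FF FK.
(* The cluster point [w] is turned into a sequential limit point; the times chosen here need not be
   bad. *)
have near_w (i : nat) : exists t : R, i%:R <= t /\ `|w - th t| < i.+1%:R^-1.
  have Fi : F (th @` [set t | i%:R <= t]).
    rewrite FE; near=> t.
    suff it : i%:R <= t by exists t.
    by near: t; exact: nbhs_pinfty_ge.
  have wi : nbhs w (ball w i.+1%:R^-1).
    by apply: nbhsx_ballx; rewrite invr_gt0.
  have [_ [[t it <-] wt]] := Fw _ _ Fi wi; exists t; split=> //.
  by move: wt; rewrite -ball_normE.
have [t_ t_w] := choice near_w.
have gw : g w = v.
  apply: (glim w t_ Tw).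
    apply/cvgryPge => A; near=> i; apply: le_trans (t_w i).1.
    by near: i; exact: nbhs_infty_ger.
  apply/cvgrPdist_lt => d d0; near=> i; apply: lt_trans (t_w i).2 _.
  by near: i; exact: near_infty_natSinv_lt (PosNum d0).
(* Since [F] clusters at [w], some bad time has its orbit point so close to [w] that [g] is within
   [e] of [v] there, a contradiction. *)
have : g u @[u --> within Theta (nbhs w)] --> v.
  by rewrite -gw; have /subspace_continuousP := gcont; exact.
move=> /cvgrPdist_lt /(_ _ e0) /(Fw _ _ Forbit)[_ [[t [t0 badt] <-] gt]].
apply/badt/gt.
by apply: thcl; apply: subset_closure; exists t.
Unshelve. all: by end_near.
Qed.

Theorem theorem1 (R : realType) (n p : nat) (Theta : set 'rV[R]_p)
    (f : 'rV[R]_n -> 'rV[R]_p -> R) (s : 'rV[R]_p -> 'rV[R]_p)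
    (xo : 'rV[R]_n) (Hc : 'rV[R]_p -> 'rV[R]_n)
    (Theta_nbhs : nbhs (0 : 'rV[R]_p) Theta)
    (f_convex : forall theta, Theta theta ->
       convex_function (E := 'rV[R]_n) setT (f^~ theta))
    (f_differentiable : forall theta, Theta theta ->
       forall x, differentiable (f^~ theta : 'rV[R]_n -> R^o) x)
    (f_grad_lipschitz : forall theta, Theta theta ->
       [lipschitz grad_x f x theta | x in [set: 'rV[R]_n]])
    (* regularity of f in the parameter *)
    (f_grad_continuous : forall x : 'rV[R]_n,
       {within Theta, continuous (grad_x f x)})
    (s_smooth : smooth_on Theta s)
    (s_equilibrium : s 0 = 0)
    (s_bounded : bounded_trajectories Theta s)
    (* trajectories do not accumulate at points missing from Theta;
       automatic when Theta is closed, e.g. all of R^p *)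
    (s_closure : forall th, exo_solution Theta s th ->
       closure (orbit_of th) `<=` Theta)
    (critical_exists : forall th, exo_solution Theta s th ->
       exists x, critical_trajectory f th x)
    (critical_continuous : forall th, exo_solution Theta s th ->
       forall x, critical_trajectory f th x ->
         {within [set t : R | 0 <= t], continuous x})
    (xo_critical : locally_unique_critical_point (f^~ 0) xo)
    (Hc_continuous : {within Theta, continuous Hc})
    (Hc0 : Hc 0 = xo) :
  exactly_asymptotically_tracks Theta f s Hc <->
  exists Theta_o : set 'rV[R]_p,
    [/\ nbhs (0 : 'rV[R]_p) Theta_o, Theta_o `<=` Theta
      & zeros_gradient_on f Hc (limit_set Theta s Theta_o)].
Proof.
have gcont : {within Theta,
    continuous (fun theta => grad_x f (Hc theta) theta)}.
  apply: grad_along_continuous => // theta Ttheta.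
  by apply: lipschitz_continuous; exact: f_grad_lipschitz.
(* The same neighborhood of initial values serves both directions. *)
split=> [[U [U0 UT track]]|[U [U0 UT zero]]]; exists U; split=> //.
- move=> w [th0 Uth0 [Tw [th [t_ [sol thE t_oo thw]]]]].
  (* Along [t_] the gradient tends to its value at [w] by continuity and to 0 by tracking. *)
  apply: (@cvg_unique _ _ (grad_x f (Hc (th (t_ i))) (th (t_ i)) @[i --> \oo])).
  + exact: norm_hausdorff.
  + have /subspace_continuousP /(_ _ Tw) := gcont.
    apply: cvg_comp => A /thw wA.
    (* A solution is known to lie in [Theta] only at nonnegative times, and [t_ i] is nonnegative
       only eventually. *)
    have tTheta : \forall i \near \oo, Theta (th (t_ i)).
      move/cvgryPge : t_oo => /(_ 0); apply: filterS => i ti0.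
      exact: (sol _ ti0).1.
    have {}wA : \forall i \near \oo, Theta (th (t_ i)) -> A (th (t_ i)) := wA.
    by apply: filterS2 wA tTheta => i; apply.
  + rewrite -thE in Uth0; exact: cvg_comp t_oo (track th sol Uth0).
- move=> th sol Uth0.
  apply: (@cvg_along_trajectory _ _ _ _
    (fun theta => grad_x f (Hc theta) theta) _ _ gcont).
  + exact: s_bounded.2 th sol.
  + exact: s_closure sol.
  move=> w t_ Tw t_oo thw; apply: zero; exists (th 0) => //.
  by split=> //; exists th, t_.
Qed.
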